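(* Let $G$ be a connected graph and let $d\ge 2$ be an integer. Then $S\subseteq V(G)$ is a general $d$-position set if and only if the following conditions hold: (i) $\langle S\rangle$ is a disjoint union of complete graphs $Q_1,\ldots,Q_\ell$. (ii) If $Q_i\nparallel Q_j$, $i\ne j$, then $d_G(Q_i,Q_j)\ge d$. (iii) If $d_G(Q_i,Q_j)+d_G(Q_j,Q_k)=d_G(Q_i,Q_k)$ for pairwise distinct indices $i,j,k\in\{1,\ldots,\ell\}$, then $d_G(Q_i,Q_k)>d$.
   Context: Graphs are finite, simple, undirected. $d_G(u,w)$ denotes the shortest-path distance in $G$, and $I_G(u,w)=\{x\in V(G): d_G(u,w)=d_G(u,x)+d_G(x,w)\}$. A set $S\subseteq V(G)$ is a general $d$-position set if for any three distinct vertices $u,v,w\in S$ with $v\in I_G(u,w)$ we have $d_G(u,w)>d$. $\langle S\rangle$ denotes the subgraph of $G$ induced by $S$; in condition (i), $Q_1,\ldots,Q_\ell$ are the connected components of $\langle S\rangle$, each of which is complete. For subgraphs $H_1,H_2$ of $G$, $d_G(H_1,H_2)=\min\{d_G(h_1,h_2): h_1\in V(H_1),h_2\in V(H_2)\}$. The subgraphs $H_1$ and $H_2$ are parallel, written $H_1\parallel H_2$, if $d_G(h_1,h_2)=d_G(H_1,H_2)$ for every $h_1\in V(H_1)$ and $h_2\in V(H_2)$; otherwise we write $H_1\nparallel H_2$. *)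

(* Defs.v *)
From mathcomp Require Import all_boot.
Set Implicit Arguments.
Unset Strict Implicit.
Unset Printing Implicit Defensive.

Record sgraph := SGraph {
  vertex :> finType;
  edge : rel vertex;
  edge_sym : symmetric edge;
  edge_irr : irreflexive edge }.

Section Graph.
Variable G : sgraph.
Implicit Types (x y u v w : G) (S H Q : {set G}) (d : nat).

Definition connected := forall x y, connect (@edge G) x y.

Definition walk x y (n : nat) : bool :=
  [exists p : n.-tuple G, path (@edge G) x p && (last x p == y)].

(* A shortest path has fewer than #|G| edges, so the search range suffices;
   the value is #|G| when y is not reachable from x. *)
Definition dist x y : nat := find (walk x y) (iota 0 #|G|).

Definition interval u w : {set G} :=
  [set x | dist u w == dist u x + dist x w].

Definition general_position d S : Prop :=
  forall u v w, u \in S -> v \in S -> w \in S ->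
    u != v -> v != w -> u != w -> v \in interval u w -> d < dist u w.

(* Subgraphs are represented by their vertex sets, on which distance and
   parallelism alone depend. *)
Definition induced_edge S : rel G :=
  [rel x y | [&& x \in S, y \in S & edge x y]].

Definition components S : {set {set G}} :=
  equivalence_partition (connect (induced_edge S)) S.

Definition complete Q : Prop :=
  {in Q &, forall x y, x != y -> edge x y}.

(* Distances never exceed #|G|, so this is the minimum as soon as H1 and H2
   are nonempty. *)
Definition sdist (H1 H2 : {set G}) : nat :=
  \big[minn/#|G|]_(h1 in H1) \big[minn/#|G|]_(h2 in H2) dist h1 h2.

Definition parallel (H1 H2 : {set G}) : Prop :=
  {in H1 & H2, forall h1 h2, dist h1 h2 = sdist H1 H2}.

Lemma dist_le (p : seq G) x : path (@edge G) x p -> dist x (last x p) <= size p.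
Proof.
move=> xp; have [szp|] := ltnP (size p) #|G|; last first.
  by apply: leq_trans; rewrite /dist -[leqRHS](size_iota 0 #|G|) find_size.
rewrite leqNgt; apply/negP=> /(before_find 0)/negbT/negP; apply.
by rewrite nth_iota //; apply/existsP; exists (in_tuple p); rewrite /= xp eqxx.
Qed.

Lemma dist_path x y : connect (@edge G) x y ->
  exists p : seq G, [/\ path (@edge G) x p, last x p = y & size p = dist x y].
Proof.
case/connectP=> p /shortenP[q xq uq _] ->.
have szq : size q < #|G|.
  by rewrite -[_.+1]/(size (x :: q)) -(card_uniqP uq) max_card.
have hasw : has (walk x (last x q)) (iota 0 #|G|).
  apply/hasP; exists (size q); first by rewrite mem_iota.
  by apply/existsP; exists (in_tuple q); rewrite /= xq eqxx.
have := nth_find 0 hasw.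
rewrite nth_iota; last by rewrite -[X in _ < X](size_iota 0 #|G|) -has_find.
case/existsP=> r /andP[xr /eqP lr].
by exists (r : seq G); split=> //; rewrite size_tuple.
Qed.

Lemma sdist_le (H1 H2 : {set G}) x y :
  x \in H1 -> y \in H2 -> sdist H1 H2 <= dist x y.
Proof.
have minle (A : {set G}) F z : z \in A -> \big[minn/#|G|]_(i in A) F i <= F z.
  move=> zA; have := mem_index_enum z; elim: (index_enum _) => //= i r IHr.
  rewrite inE big_cons => /predU1P[<-|/IHr le_r]; first by rewrite zA geq_minl.
  by case: ifP => // _; rewrite geq_min le_r orbT.
move=> xH yH.
exact: leq_trans (minle _ (fun h1 => \big[minn/#|G|]_(h2 in H2) dist h1 h2) _ xH)
                 (minle _ (dist x) _ yH).
Qed.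

Lemma sdist_attained (H1 H2 : {set G}) : H1 != set0 -> H2 != set0 ->
  exists x y, [/\ x \in H1, y \in H2 & dist x y = sdist H1 H2].
Proof.
case/set0Pn=> x0 x0H /set0Pn[y0 y0H].
suff: sdist H1 H2 = #|G| \/
    exists x y, [/\ x \in H1, y \in H2 & dist x y = sdist H1 H2].
  case=> // E; exists x0, y0; split=> //; apply/eqP.
  rewrite eqn_leq sdist_le // andbT E.
  by rewrite /dist -[leqRHS](size_iota 0 #|G|) find_size.
pose K m := m = #|G| \/ exists x y, [/\ x \in H1, y \in H2 & dist x y = m].
have Kmin m n : K m -> K n -> K (minn m n) by rewrite /minn; case: ifP.
rewrite -/(K (sdist H1 H2)) /sdist.
apply: (big_ind K) => [||x xH]; [by left|exact: Kmin|].
apply: (big_ind K) => [||y yH]; [by left|exact: Kmin|].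
by right; exists x, y.
Qed.

End Graph.

(* Main.v *)
Require Import Defs.
From mathcomp Require Import all_boot.
Set Implicit Arguments.
Unset Strict Implicit.
Unset Printing Implicit Defensive.

(** The distance of a connected graph is a metric, and two vertices are at
    distance 1 exactly when they are adjacent; the theorem is a consequence of
    these facts and the triangle inequality.

    Let [S] be in general [d]-position with [2 <= d].  Two consecutive edges in
    [S] whose ends are not adjacent would form a geodesic of length 2, so
    adjacency in [S] is transitive up to equality and every component is
    complete ([general_position_complete]).  If two components are at distance
    less than [d], replacing a vertex of a closest pair by a neighbour in its
    component changes the distance by at most 1, and an increase would put three
    vertices of [S] on a geodesic of length at most [d]; hence all the pairs are
    closest pairs ([general_position_parallel]).  Finally, if the component
    distances add up for [Qi], [Qj], [Qk] with a sum at most [d], then both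
    terms are less than [d], so [Qj] is parallel to [Qi] and to [Qk], and any
    vertex of [Qj] lies on a geodesic between a closest pair of [Qi] and [Qk].

    Conversely, let [v] lie on a geodesic from [u] to [w], all in [S].  The
    ends [u] and [w] cannot be adjacent, so they lie in different components,
    say [Qu] and [Qw].  If the component [Qv] of [v] is [Qu], then [u] and [v]
    are at different distances from [w], so [Qu] and [Qw] are not parallel and
    [d <= sdist Qu Qw <= dist v w < dist u w]; the case [Qv = Qw] is the same.
    If the three components are distinct and one of the two parts of the
    geodesic is longer than the corresponding component distance, the condition
    on non-parallel components makes that part at least [d] long.  Otherwise
    [dist u w] is the sum of the two component distances.  If it equals
    [sdist Qu Qw], the condition on three components applies; if it is larger,
    [Qu] and [Qw] are not parallel and [d <= sdist Qu Qw < dist u w]. *)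

(** * The metric of a connected graph *)

Lemma dist_gt0 (G : sgraph) (x y : G) :
  connected G -> x != y -> 0 < dist x y.
Proof.
move=> Gconn; have [p [_ lp <-]] := dist_path (Gconn x y).
by case: p lp => //= ->; rewrite eqxx.
Qed.

Lemma dist_edge (G : sgraph) (x y : G) : edge x y -> dist x y <= 1.
Proof. by move=> xy; apply: (@dist_le G [:: y] x); rewrite /= xy. Qed.

Lemma dist_le1 (G : sgraph) (x y : G) :
  connected G -> x != y -> dist x y <= 1 -> edge x y.
Proof.
move=> Gconn; have [p [xp lp <-]] := dist_path (Gconn x y).
case: p xp lp => [_ /= ->|z [|//] /=]; first by rewrite eqxx.
by rewrite andbT => xz <-.
Qed.

Lemma dist_triangle (G : sgraph) (x y z : G) :
  connected G -> dist x z <= dist x y + dist y z.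
Proof.
move=> Gconn; have [p [xp lp <-]] := dist_path (Gconn x y).
have [q [yq lq <-]] := dist_path (Gconn y z).
rewrite -size_cat -lq -{1}lp -last_cat; apply: dist_le.
by rewrite cat_path xp lp.
Qed.

Lemma dist_sym (G : sgraph) (x y : G) : connected G -> dist x y = dist y x.
Proof.
move=> Gconn.
suff le_rev (a b : G) : dist b a <= dist a b.
  by apply/eqP; rewrite eqn_leq !le_rev.
have [p [ap lp <-]] := dist_path (Gconn a b).
have /dist_le : path (@edge G) (last a p) (rev (belast a p)).
  by rewrite rev_path (eq_path (e' := @edge G)) // => u v; rewrite edge_sym.
rewrite size_rev size_belast lp; case: p {ap} lp => [/= ->|c p _] //.
by rewrite /= rev_cons last_rcons.
Qed.

(** * Components of an induced subgraph *)

Lemma connect_induced_equivalence (G : sgraph) (S : {set G}) :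
  {in S & &, equivalence_rel (connect (induced_edge S))}.
Proof.
have symS : connect_sym (induced_edge S).
  by apply: sym_connect_sym => x y; rewrite /induced_edge /= edge_sym andbCA.
move=> x y z _ _ _; split; first exact: connect0.
by move=> /(same_connect symS)->.
Qed.

Lemma components_partition (G : sgraph) (S : {set G}) :
  partition (components S) S.
Proof. exact/equivalence_partitionP/connect_induced_equivalence. Qed.

Lemma component_sub (G : sgraph) (S Q : {set G}) :
  Q \in components S -> Q \subset S.
Proof.
move=> QS; rewrite -(cover_partition (components_partition S)).
exact: bigcup_max QS _.
Qed.

Lemma component_neq0 (G : sgraph) (S Q : {set G}) :
  Q \in components S -> Q != set0.
Proof.
have /and3P[_ _ S0] := components_partition S.
by apply: contraTneq => ->.
Qed.

Lemma component_exists (G : sgraph) (S : {set G}) (x : G) :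
  x \in S -> exists2 Q, Q \in components S & x \in Q.
Proof.
rewrite -{1}(cover_partition (components_partition S)) => /bigcupP[Q QS xQ].
by exists Q.
Qed.

Lemma component_connect (G : sgraph) (S Q : {set G}) (x y : G) :
  Q \in components S -> x \in Q -> y \in Q -> connect (induced_edge S) x y.
Proof.
move=> QS xQ yQ; have /subsetP sQS := component_sub QS.
have /and3P[_ tiS _] := components_partition S.
rewrite -(pblock_equivalence_partition (@connect_induced_equivalence G S));
  by [rewrite -/(components S) (def_pblock tiS QS xQ) | apply: sQS].
Qed.

Lemma component_disjoint (G : sgraph) (S Q Q' : {set G}) (x y : G) :
  Q \in components S -> Q' \in components S -> Q != Q' ->
  x \in Q -> y \in Q' -> x != y.
Proof.
move=> QS QS' neQ xQ yQ; have /and3P[_ tiS _] := components_partition S.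
apply: contraNneq neQ => xy; rewrite -xy in yQ.
by rewrite -(def_pblock tiS QS xQ) (def_pblock tiS QS' yQ).
Qed.

Lemma sdist_component_gt0 (G : sgraph) (S Q Q' : {set G}) :
  connected G -> Q \in components S -> Q' \in components S -> Q != Q' ->
  0 < sdist Q Q'.
Proof.
move=> Gconn QS QS' neQ.
have [x [y [xQ yQ <-]]] :=
  sdist_attained (component_neq0 QS) (component_neq0 QS').
exact/dist_gt0/(component_disjoint QS QS' neQ).
Qed.

(** * Sets in general position *)

(** A path of length 2 between non-adjacent vertices is a geodesic of length
    [2 <= d], so edges of [S] compose: along a path in [S] all vertices stay
    equal or adjacent to its origin. *)
Lemma general_position_complete (G : sgraph) (d : nat) (S Q : {set G}) :
  connected G -> 2 <= d -> general_position d S -> Q \in components S ->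
  complete Q.
Proof.
move=> Gconn d_ge2 gpS QS x y xQ yQ neq_xy.
have /connectP[p] := component_connect QS xQ yQ.
elim/last_ind: p y neq_xy {yQ} => [|p z IHp] y neq_xy /=.
  by move=> _ Eyx; rewrite Eyx eqxx in neq_xy.
rewrite rcons_path last_rcons => /andP[xp pz] Eyz; rewrite -{z}Eyz in pz.
have /and3P[vS yS vy] := pz; set v := last x p in vS vy.
have [-> //|neq_xv] := eqVneq x v.
have xv := IHp v neq_xv xp erefl.
have neq_vy : v != y by apply: contraTneq vy => ->; rewrite edge_irr.
apply: dist_le1 => //; rewrite leqNgt; apply/negP=> xy_gt1.
have xvy := dist_triangle x v y Gconn.
have Exv : dist x v = 1 by apply/eqP; rewrite eqn_leq dist_edge ?dist_gt0.
have Evy : dist v y = 1 by apply/eqP; rewrite eqn_leq dist_edge ?dist_gt0.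
rewrite Exv Evy in xvy.
have Exy : dist x y = 2 by apply/eqP; rewrite eqn_leq xvy.
have xS := subsetP (component_sub QS) x xQ.
have := gpS x v y xS vS yS neq_xv neq_vy neq_xy.
by rewrite inE Exy Exv Evy ltnNge d_ge2 => /(_ isT).
Qed.

(** If moving to the neighbour increased the distance, then [u] would lie on a
    geodesic from [u'] to [w] of length [(dist u w).+1 <= d]. *)
Lemma general_position_dist_neighbor (G : sgraph) (d : nat) (S : {set G})
    (u u' w : G) :
  connected G -> general_position d S -> u \in S -> u' \in S -> w \in S ->
  edge u' u -> u != w -> u' != w -> dist u w < d -> dist u' w <= dist u w.
Proof.
move=> Gconn gpS uS u'S wS u'u neq_uw neq_u'w uw_lt; rewrite leqNgt.
apply/negP=> u'w_gt.
have neq_u'u : u' != u by apply: contraTneq u'u => ->; rewrite edge_irr.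
have Eu'u : dist u' u = 1 by apply/eqP; rewrite eqn_leq dist_edge ?dist_gt0.
have Eu'w : dist u' w = 1 + dist u w.
  by apply/eqP; rewrite eqn_leq -{1}Eu'u dist_triangle.
have := gpS u' u w u'S uS wS neq_u'u neq_uw neq_u'w.
by rewrite inE Eu'w Eu'u eqxx ltnNge uw_lt => /(_ isT).
Qed.

(** From a closest pair, each of the two vertices can be moved within its
    complete component without increasing the distance. *)
Lemma general_position_parallel (G : sgraph) (d : nat) (S Q Q' : {set G}) :
  connected G -> 2 <= d -> general_position d S ->
  Q \in components S -> Q' \in components S -> Q != Q' -> sdist Q Q' < d ->
  parallel Q Q'.
Proof.
move=> Gconn d_ge2 gpS QS QS' neQ lt_d x' y' x'Q y'Q.
have [x [y [xQ yQ Exy]]] :=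
  sdist_attained (component_neq0 QS) (component_neq0 QS').
have inS z : z \in Q -> z \in S := subsetP (component_sub QS) z.
have inS' z : z \in Q' -> z \in S := subsetP (component_sub QS') z.
have neq a b : a \in Q -> b \in Q' -> a != b.
  exact: component_disjoint QS QS' neQ.
have cQ := general_position_complete Gconn d_ge2 gpS QS.
have cQ' := general_position_complete Gconn d_ge2 gpS QS'.
have le_x'y : dist x' y <= sdist Q Q'.
  rewrite -Exy; have [-> //|neq_x] := eqVneq x' x.
  apply: (general_position_dist_neighbor Gconn gpS (inS x xQ) (inS x' x'Q)
           (inS' y yQ) (cQ x' x x'Q xQ neq_x) (neq x y xQ yQ)
           (neq x' y x'Q yQ)).
  by rewrite Exy.
have lt_x'y := leq_ltn_trans le_x'y lt_d.
apply/eqP; rewrite eqn_leq sdist_le // andbT.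
apply: leq_trans le_x'y; have [-> //|neq_y] := eqVneq y' y.
rewrite ![dist x' _]dist_sym //.
have neq' b : b \in Q' -> b != x' by rewrite eq_sym; apply: neq.
apply: (general_position_dist_neighbor Gconn gpS (inS' y yQ) (inS' y' y'Q)
         (inS x' x'Q) (cQ' y' y y'Q yQ neq_y) (neq' y yQ) (neq' y' y'Q)).
by rewrite dist_sym.
Qed.

(** * The characterization *)

Theorem theorem4p1 (G : sgraph) (d : nat) (S : {set G})
    (Gconn : connected G) (d_ge2 : 2 <= d) :
  general_position d S <->
  [/\ forall Q, Q \in components S -> complete Q,
      forall Qi Qj, Qi \in components S -> Qj \in components S ->
        Qi != Qj -> ~ parallel Qi Qj -> d <= sdist Qi Qj
    & forall Qi Qj Qk,
        Qi \in components S -> Qj \in components S -> Qk \in components S ->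
        Qi != Qj -> Qj != Qk -> Qi != Qk ->
        sdist Qi Qj + sdist Qj Qk = sdist Qi Qk -> d < sdist Qi Qk].
Proof.
split=> [gpS | [cS parS sumS] u v w uS vS wS neq_uv neq_vw neq_uw].
  split=> [Q|Qi Qj iS jS neq_ij npar|
           Qi Qj Qk iS jS kS neq_ij neq_jk neq_ik Eik].
  - exact: general_position_complete gpS.
  - rewrite leqNgt; apply/negP=> lt_d; apply: npar.
    exact: general_position_parallel gpS iS jS neq_ij lt_d.
  rewrite ltnNge; apply/negP=> le_d.
  have ij_gt0 := sdist_component_gt0 Gconn iS jS neq_ij.
  have jk_gt0 := sdist_component_gt0 Gconn jS kS neq_jk.
  have par_ij : parallel Qi Qj.
    apply: (general_position_parallel Gconn d_ge2 gpS) => //.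
    by apply: leq_trans le_d; rewrite -Eik -[X in X < _]addn0 ltn_add2l.
  have par_jk : parallel Qj Qk.
    apply: (general_position_parallel Gconn d_ge2 gpS) => //.
    by apply: leq_trans le_d; rewrite -Eik -[X in X < _]add0n ltn_add2r.
  have [x [z [xi zk Exz]]] :=
    sdist_attained (component_neq0 iS) (component_neq0 kS).
  have /set0Pn[y yj] := component_neq0 jS.
  have := gpS x y z (subsetP (component_sub iS) x xi)
    (subsetP (component_sub jS) y yj) (subsetP (component_sub kS) z zk)
    (component_disjoint iS jS neq_ij xi yj)
    (component_disjoint jS kS neq_jk yj zk)
    (component_disjoint iS kS neq_ik xi zk).
  by rewrite inE Exz par_ij // par_jk // Eik eqxx ltnNge le_d => /(_ isT).
rewrite inE => /eqP Euw.
have uv_gt0 := dist_gt0 Gconn neq_uv; have vw_gt0 := dist_gt0 Gconn neq_vw.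
have lt_uv : dist u v < dist u w by rewrite Euw -[X in X < _]addn0 ltn_add2l.
have lt_vw : dist v w < dist u w by rewrite Euw -[X in X < _]add0n ltn_add2r.
have [Qu QuS uQ] := component_exists uS.
have [Qv QvS vQ] := component_exists vS.
have [Qw QwS wQ] := component_exists wS.
have neQuw : Qu != Qw.
  apply/eqP=> Euw'; rewrite -Euw' in wQ.
  have := dist_edge (cS Qu QuS u w uQ wQ neq_uw).
  by rewrite leqNgt (leq_ltn_trans uv_gt0 lt_uv).
have [Euv|neQuv] := eqVneq Qu Qv.
  (* [u] and [v] are at different distances from [w] *)
  rewrite -Euv in vQ; apply: leq_ltn_trans (lt_vw).
  apply: leq_trans (sdist_le vQ wQ); apply: parS => // par.
  by move: lt_vw; rewrite !par // ltnn.
have [Evw|neQvw] := eqVneq Qv Qw.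
  (* [v] and [w] are at different distances from [u] *)
  rewrite -Evw in wQ neQuw; apply: leq_ltn_trans (lt_uv).
  apply: leq_trans (sdist_le uQ vQ); apply: parS => // par.
  by move: lt_uv; rewrite !par // ltnn.
have [Euv|neuv] := eqVneq (dist u v) (sdist Qu Qv); last first.
  apply: leq_ltn_trans lt_uv; apply: leq_trans (sdist_le uQ vQ).
  by apply: parS => // par; rewrite par ?eqxx in neuv.
have [Evw|nevw] := eqVneq (dist v w) (sdist Qv Qw); last first.
  apply: leq_ltn_trans lt_vw; apply: leq_trans (sdist_le vQ wQ).
  by apply: parS => // par; rewrite par ?eqxx in nevw.
have [Es|neuw] := eqVneq (dist u w) (sdist Qu Qw).
  by rewrite Es; apply: (sumS Qu Qv Qw) => //; rewrite -Euv -Evw -Euw.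
have lt_s : sdist Qu Qw < dist u w by rewrite ltn_neqAle eq_sym neuw sdist_le.
apply: leq_ltn_trans lt_s; apply: parS => // par.
by rewrite par ?eqxx in neuw.
Qed.
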